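(* For every integer $k \geq 0$ and real $x$, \[ D_k(x) = (-1)^k k!\, H_{k+1}^{(-x)} \qquad\text{and}\qquad \widehat{D}_k(x) = k!\, H_{k+1}^{(x-1)}, \] where \[ H_{k+1}^{(-x)} = \sum_{j=0}^{k} \frac{(-1)^j}{k+1-j}\binom{x}{j} \qquad\text{and}\qquad H_{k+1}^{(x-1)} = \sum_{j=0}^{k} \frac{1}{k+1-j}\binom{x+j-2}{j}. \]
   Context: The Daehee polynomials of the first kind $D_k(x)$ are defined by $\sum_{k\ge 0} D_k(x)\frac{t^k}{k!} = \frac{\ln(1+t)}{t}(1+t)^x$, and those of the second kind $\widehat{D}_k(x)$ by $\sum_{k\ge 0} \widehat{D}_k(x)\frac{t^k}{k!} = \frac{\ln(1-t)}{-t}(1-t)^{1-x}$. For real $x$, the hyperharmonic polynomials $H_r^{(x)}$ ($r\ge 0$) are defined by the generating function $\sum_{r\ge0} H_r^{(x)} t^r = -\frac{\ln(1-t)}{(1-t)^x}$ (so $H_0^{(x)}=0$). For real $y$ and integer $m\ge0$, $\binom{y}{m} = \frac{y(y-1)\cdots(y-m+1)}{m!}$ for $m\ge1$ and $\binom{y}{0}=1$. *)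

(* Defs.v *)
From Stdlib Require Import Reals Factorial ClassicalEpsilon.
From Coquelicot Require Import Coquelicot.
Open Scope R_scope.

(* The point t = 0 is excluded because the generating functions below are
   quotients by t; the coefficients are still determined by the values of F
   on a punctured neighbourhood of 0. *)
Definition is_gf (a : nat -> R) (F : R -> R) : Prop :=
  locally' 0 (fun t : R => is_pseries a t (F t)).

(* The choice is harmless: by the identity theorem for power series, at most one
   sequence satisfies is_gf _ F. *)
Definition gf_coef (F : R -> R) : nat -> R :=
  epsilon (inhabits (fun _ : nat => 0)) (fun a => is_gf a F).

Definition egf_coef (F : R -> R) : nat -> R :=
  epsilon (inhabits (fun _ : nat => 0))
    (fun a => is_gf (fun k => a k / INR (fact k)) F).

Definition Daehee1 (k : nat) (x : R) : R :=
  egf_coef (fun t => ln (1 + t) / t * Rpower (1 + t) x) k.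

Definition Daehee2 (k : nat) (x : R) : R :=
  egf_coef (fun t => ln (1 - t) / (- t) * Rpower (1 - t) (1 - x)) k.

Definition hyperharmonic (r : nat) (x : R) : R :=
  gf_coef (fun t => - (ln (1 - t) / Rpower (1 - t) x)) r.

Fixpoint falling (y : R) (m : nat) : R :=
  match m with
  | O => 1
  | S m' => falling y m' * (y - INR m')
  end.

Definition gbinom (y : R) (m : nat) : R := falling y m / INR (fact m).

(* Main.v *)
(** The sequence [H^(y)] is the Cauchy product of the coefficients of
    [(1 - t)^(-y)], given by the binomial series, with those of [- ln (1 - t)].
    The Daehee generating functions are [F t / t] and [F (- t) / (- t)] for [F]
    a hyperharmonic generating function, so everything follows from uniqueness
    of power series coefficients.  The binomial and logarithmic expansions are
    only needed near [0], and come from the differential equations that the two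
    power series satisfy. *)
Require Import Defs.
From Stdlib Require Import Reals Factorial Lra Lia ClassicalEpsilon.
From Coquelicot Require Import Coquelicot.
Open Scope R_scope.

(** * Sequences with a given generating function *)

Lemma ball_0_iff (e t : R) : ball 0 e t <-> Rabs t < e.
Proof.
  change (Rabs (t + - 0) < e <-> Rabs t < e).
  now replace (t + - 0) with t by ring.
Qed.

Lemma locally'_0_iff (P : R -> Prop) :
  locally' 0 P <->
  exists r, 0 < r /\ forall t, t <> 0 -> Rabs t < r -> P t.
Proof.
  split.
  - intros [e He]; exists e; split; [apply cond_pos|].
    intros t Ht Hr; apply He; auto; now apply ball_0_iff.
  - intros (r & Hr & H); exists (mkposreal r Hr).
    intros t Hb Ht; apply H; auto; exact (proj1 (ball_0_iff _ _) Hb).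
Qed.

Lemma Rbar_lt_0_radius (c : Rbar) :
  Rbar_lt 0 c ->
  exists r, 0 < r /\ forall t, Rabs t < r -> Rbar_lt (Rabs t) c.
Proof.
  destruct c as [c| |]; simpl; intros H.
  - now exists c.
  - exists 1; split; [lra|auto].
  - contradiction.
Qed.

(** Convergence at the single point [r / 2] is enough: it forces the terms there to tend to 0, which
    fails strictly outside the disk of convergence. *)
Lemma is_gf_CV_radius (a : nat -> R) (F : R -> R) :
  is_gf a F -> Rbar_lt 0 (CV_radius a).
Proof.
  intros H; apply locally'_0_iff in H; destruct H as (r & Hr & H).
  assert (Ht : is_pseries a (r / 2) (F (r / 2))).
  { apply H; [lra|]; rewrite Rabs_pos_eq; lra. }
  apply Rbar_lt_le_trans with (r / 2); [simpl; lra|].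
  apply Rbar_not_lt_le; intros Hlt.
  apply (CV_disk_outside a (r / 2)).
  - rewrite Rabs_pos_eq; [exact Hlt|lra].
  - apply ex_series_lim_0; exists (F (r / 2)); now apply is_pseries_R.
Qed.

Lemma is_gf_ext (a b : nat -> R) (F G : R -> R) :
  (forall n, a n = b n) -> locally' 0 (fun t => F t = G t) ->
  is_gf a F -> is_gf b G.
Proof.
  unfold is_gf; rewrite !locally'_0_iff.
  intros Hab (r & Hr & HFG) (s & Hs & H).
  exists (Rmin r s); split; [now apply Rmin_pos|].
  intros t Ht Hlt.
  rewrite <- HFG; auto; [|now apply Rlt_le_trans with (1 := Hlt), Rmin_l].
  apply is_pseries_ext with a; auto.
  apply H; auto; now apply Rlt_le_trans with (1 := Hlt), Rmin_r.
Qed.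

(** The two sums are known to agree only for [t <> 0]. Both are continuous at 0, so their limits
    [a O] and [b O] coincide; the sums then agree on a full neighbourhood and the identity theorem
    applies. *)
Lemma is_gf_unique (a b : nat -> R) (F : R -> R) :
  is_gf a F -> is_gf b F -> forall n, a n = b n.
Proof.
  intros Ha Hb n.
  assert (Ca := is_gf_CV_radius _ _ Ha); assert (Cb := is_gf_CV_radius _ _ Hb).
  assert (E : locally' 0 (fun t => PSeries a t = PSeries b t)).
  { unfold is_gf in Ha, Hb; rewrite !locally'_0_iff in *.
    destruct Ha as (r & Hr & Ha), Hb as (s & Hs & Hb).
    exists (Rmin r s); split; [now apply Rmin_pos|].
    intros t Ht Hlt.
    rewrite (is_pseries_unique _ _ _ (Ha t Ht (Rlt_le_trans _ _ _ Hlt (Rmin_l _ _)))).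
    now rewrite (is_pseries_unique _ _ _ (Hb t Ht (Rlt_le_trans _ _ _ Hlt (Rmin_r _ _)))). }
  assert (L : forall c, Rbar_lt 0 (CV_radius c) -> is_lim (PSeries c) 0 (c O)).
  { intros c Hc; rewrite <- (PSeries_0 c).
    apply is_lim_continuity, PSeries_continuity; now rewrite Rabs_R0. }
  assert (E0 : a O = b O).
  { assert (La := is_lim_ext_loc _ _ 0 _ E (L a Ca)).
    apply is_lim_unique in La; rewrite (is_lim_unique _ _ _ (L b Cb)) in La.
    now injection La. }
  apply PSeries_ext_recip; auto.
  apply locally'_0_iff in E; destruct E as (r & Hr & E).
  exists (mkposreal r Hr); intros t Ht.
  destruct (Req_dec t 0) as [->|Ht0].
  - now rewrite !PSeries_0.
  - apply E; auto; exact (proj1 (ball_0_iff _ _) Ht).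
Qed.

(** Any explicit [a] serves twice: it shows that the choice made by [epsilon] is a genuine one, and
    uniqueness then identifies the chosen sequence with it. *)
Lemma gf_coef_eq (a : nat -> R) (F : R -> R) :
  is_gf a F -> forall n, gf_coef F n = a n.
Proof.
  intros H; apply is_gf_unique with F; auto.
  unfold gf_coef; apply epsilon_spec; now exists a.
Qed.

Lemma egf_coef_eq (a : nat -> R) (F : R -> R) :
  is_gf a F -> forall n, egf_coef F n = INR (fact n) * a n.
Proof.
  intros H n.
  assert (He : is_gf (fun k => egf_coef F k / INR (fact k)) F).
  { unfold egf_coef.
    apply (epsilon_spec _ (fun a => is_gf (fun k => a k / INR (fact k)) F)).
    exists (fun k => INR (fact k) * a k).
    apply is_gf_ext with (3 := H).
    - intros k; field; apply INR_fact_neq_0.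
    - now apply filter_forall. }
  rewrite <- (is_gf_unique _ _ _ He H n); field; apply INR_fact_neq_0.
Qed.

(** The Cauchy product relies on absolute convergence, so [t] is kept inside both disks of
    convergence as well as both neighbourhoods. *)
Lemma is_gf_mult (a b : nat -> R) (F G : R -> R) :
  is_gf a F -> is_gf b G -> is_gf (PS_mult a b) (fun t => F t * G t).
Proof.
  intros Ha Hb.
  destruct (Rbar_lt_0_radius _ (is_gf_CV_radius _ _ Ha)) as (ra & Hra & Ca).
  destruct (Rbar_lt_0_radius _ (is_gf_CV_radius _ _ Hb)) as (rb & Hrb & Cb).
  unfold is_gf in *; rewrite !locally'_0_iff in *.
  destruct Ha as (r & Hr & Ha), Hb as (s & Hs & Hb).
  exists (Rmin (Rmin ra rb) (Rmin r s)); split; [now repeat apply Rmin_pos|].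
  intros t Ht Hlt; apply Rmin_Rgt_l in Hlt; destruct Hlt as [H1 H2].
  apply Rmin_Rgt_l in H1, H2; destruct H1, H2.
  apply is_pseries_mult; auto.
Qed.

Lemma is_gf_opp_arg (a : nat -> R) (F : R -> R) :
  is_gf a F -> is_gf (fun n => (-1) ^ n * a n) (fun t => F (- t)).
Proof.
  unfold is_gf; rewrite !locally'_0_iff; intros (r & Hr & H).
  exists r; split; auto; intros t Ht Hlt.
  assert (Hs : is_pseries a (- t) (F (- t))).
  { apply H; [lra|now rewrite Rabs_Ropp]. }
  apply is_pseries_R; apply is_pseries_R in Hs.
  apply is_series_ext with (2 := Hs); intros n; cbv beta.
  replace (- t) with (-1 * t) by ring; rewrite Rpow_mult_distr.
  change (a n * ((-1) ^ n * t ^ n) = (-1) ^ n * a n * t ^ n); ring.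
Qed.

Lemma is_gf_div_arg (a : nat -> R) (F : R -> R) :
  a O = 0 -> is_gf a F -> is_gf (fun n => a (S n)) (fun t => F t / t).
Proof.
  intros H0; unfold is_gf; rewrite !locally'_0_iff; intros (r & Hr & H).
  exists r; split; auto; intros t Ht Hlt.
  assert (Hd := is_pseries_decr_1 a t (/ t) (F t) (Rinv_l t Ht) (H t Ht Hlt)).
  rewrite H0 in Hd.
  change (is_pseries (fun n => a (S n)) t (/ t * (F t + - 0))) in Hd.
  now replace (F t / t) with (/ t * (F t + - 0)) by (field; auto).
Qed.

(** * The binomial and logarithmic series near 0 *)

Lemma CV_radius_pos_geom (a : nat -> R) (M : R) :
  0 < M -> (forall n, Rabs (a n) <= M ^ n) -> Rbar_lt 0 (CV_radius a).
Proof.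
  intros HM H.
  apply Rbar_lt_le_trans with (/ M); [now apply Rinv_0_lt_compat|].
  apply (proj1 (CV_radius_bounded a)).
  exists 1; intros n.
  rewrite Rabs_mult, <- RPow_abs, (Rabs_pos_eq (/ M)), pow_inv
    by (apply Rlt_le, Rinv_0_lt_compat, HM).
  assert (HMn := pow_lt M n HM).
  apply Rmult_le_reg_r with (M ^ n); auto.
  rewrite Rmult_assoc, Rinv_l, Rmult_1_l, Rmult_1_r by lra; auto.
Qed.

Lemma null_derive_eq_at_0 (f : R -> R) (r t : R) :
  (forall u, Rabs u < r -> is_derive f u 0) -> Rabs t < r -> f t = f 0.
Proof.
  intros H Ht; apply Rabs_def2 in Ht.
  destruct (Rtotal_order t 0) as [Hlt|[->|Hlt]]; auto.
  - apply eq_is_derive; auto.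
    intros u Hu; apply H, Rabs_def1; lra.
  - symmetry; apply eq_is_derive; auto.
    intros u Hu; apply H, Rabs_def1; lra.
Qed.

Lemma gbinom_S (x : R) (n : nat) :
  INR (S n) * gbinom x (S n) = (x - INR n) * gbinom x n.
Proof.
  unfold gbinom; cbn [falling]; rewrite fact_simpl, mult_INR.
  field; split; [apply INR_fact_neq_0|apply not_0_INR; lia].
Qed.

(** A crude bound that yields a positive radius of convergence. By [gbinom_S], the induction reduces
    to [Rabs x + n <= (n + 1) * (Rabs x + 1)]. *)
Lemma gbinom_bound (x : R) (n : nat) : Rabs (gbinom x n) <= (Rabs x + 1) ^ n.
Proof.
  induction n as [|n IH].
  - unfold gbinom; simpl; rewrite Rdiv_1_r, Rabs_R1; lra.
  - assert (Hn := pos_INR n); assert (Hx := Rabs_pos x).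
    assert (HS : 0 < INR (S n)) by (apply lt_0_INR; lia).
    apply Rmult_le_reg_l with (INR (S n)); auto.
    rewrite <- (Rabs_pos_eq (INR (S n))) at 1 by lra.
    rewrite <- Rabs_mult, gbinom_S, Rabs_mult.
    apply Rle_trans with ((Rabs x + INR n) * (Rabs x + 1) ^ n).
    + apply Rmult_le_compat; try apply Rabs_pos; auto.
      unfold Rminus; eapply Rle_trans; [apply Rabs_triang|].
      rewrite Rabs_Ropp, (Rabs_pos_eq (INR n)); lra.
    + rewrite S_INR; simpl.
      assert (0 < (Rabs x + 1) ^ n) by (apply pow_lt; lra).
      rewrite <- Rmult_assoc; apply Rmult_le_compat_r; [lra|nra].
Qed.

Lemma CV_radius_gbinom (x : R) : Rbar_lt 0 (CV_radius (gbinom x)).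
Proof.
  apply CV_radius_pos_geom with (Rabs x + 1); [|apply gbinom_bound].
  assert (H := Rabs_pos x); lra.
Qed.

(** Comparing coefficients of [t ^ n] turns the equation into the recurrence [gbinom_S]. *)
Lemma gbinom_series_ode (x t : R) :
  Rbar_lt (Rabs t) (CV_radius (gbinom x)) ->
  (1 + t) * PSeries (PS_derive (gbinom x)) t = x * PSeries (gbinom x) t.
Proof.
  intros Ht.
  assert (Hd : ex_pseries (PS_derive (gbinom x)) t).
  { apply CV_radius_inside; now rewrite CV_radius_derive. }
  rewrite <- (PSeries_scal x).
  rewrite Rmult_plus_distr_r, Rmult_1_l, <- PSeries_incr_1, <- PSeries_plus; auto.
  - apply PSeries_ext; intros n.
    unfold PS_plus, PS_scal, PS_incr_1, PS_derive.
    destruct n as [|n];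
      [change (INR 1 * gbinom x 1 + 0 = x * gbinom x 0)
      |change (INR (S (S n)) * gbinom x (S (S n)) + INR (S n) * gbinom x (S n)
               = x * gbinom x (S n))];
      rewrite gbinom_S; simpl INR; ring.
  - apply ex_pseries_incr_1; auto.
Qed.

Lemma is_gf_binomial (x : R) :
  is_gf (gbinom x) (fun t => Rpower (1 + t) x).
Proof.
  destruct (Rbar_lt_0_radius _ (CV_radius_gbinom x)) as (s & Hs & Cs).
  apply locally'_0_iff; exists (Rmin s 1); split; [apply Rmin_pos; lra|].
  intros t _ Ht.
  (* The series times [(1 + u) ^ (- x)]: by the differential equation its derivative vanishes. The
     bound 1 on the radius keeps [1 + u] positive. *)
  set (f := fun u => PSeries (gbinom x) u * exp (- x * ln (1 + u))).
  assert (Hf : f t = f 0).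
  { apply null_derive_eq_at_0 with (Rmin s 1); auto.
    intros u Hu; apply Rmin_Rgt_l in Hu; destruct Hu as [Hus Hu1].
    apply Rabs_def2 in Hu1.
    assert (Hd := is_derive_PSeries _ _ (Cs u Hus)).
    assert (Ho := gbinom_series_ode x u (Cs u Hus)).
    unfold f; auto_derive.
    - repeat split; [now exists (PSeries (PS_derive (gbinom x)) u)|lra].
    - change (fun v => PSeries (gbinom x) v) with (PSeries (gbinom x)).
      rewrite (is_derive_unique _ _ _ Hd).
      replace (PSeries (PS_derive (gbinom x)) u)
        with (x * PSeries (gbinom x) u / (1 + u))
        by (rewrite <- Ho; field; lra).
      field; lra. }
  apply Rmin_Rgt_l in Ht; destruct Ht as [Hts Ht1].
  assert (Hv : PSeries (gbinom x) t = Rpower (1 + t) x).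
  (* The constant value of [f] is [f 0 = gbinom x 0 = 1]. *)
  { unfold f in Hf; rewrite PSeries_0, Rplus_0_r, ln_1, Rmult_0_r, exp_0 in Hf.
    replace (gbinom x 0) with 1 in Hf by (unfold gbinom; simpl; field).
    unfold Rpower.
    replace (- x * ln (1 + t)) with (- (x * ln (1 + t))) in Hf by ring.
    rewrite exp_Ropp in Hf; assert (He := exp_pos (x * ln (1 + t))).
    apply Rmult_eq_reg_r with (/ exp (x * ln (1 + t)));
      [|apply Rinv_neq_0_compat; lra].
    rewrite Hf; field; lra. }
  rewrite <- Hv; apply PSeries_correct, CV_radius_inside, Cs, Hts.
Qed.

(* [/ INR 0 = 0] is the correct constant coefficient of [- ln (1 - t)]. *)
Lemma is_gf_log : is_gf (fun n => / INR n) (fun t => - ln (1 - t)).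
Proof.
  assert (C : Rbar_lt 0 (CV_radius (fun n => / INR n))).
  { apply CV_radius_pos_geom with 1; [lra|]; intros [|n]; rewrite pow1.
    - simpl; rewrite Rinv_0, Rabs_R0; lra.
    - assert (1 <= INR (S n)) by (rewrite S_INR; assert (H := pos_INR n); lra).
      rewrite Rabs_pos_eq by (apply Rlt_le, Rinv_0_lt_compat; lra).
      rewrite <- Rinv_1; apply Rinv_le_contravar; lra. }
  destruct (Rbar_lt_0_radius _ C) as (s & Hs & Cs).
  apply locally'_0_iff; exists (Rmin s 1); split; [apply Rmin_pos; lra|].
  intros t _ Ht.
  set (f := fun u => PSeries (fun n => / INR n) u + ln (1 - u)).
  assert (Hf : f t = f 0).
  { apply null_derive_eq_at_0 with (Rmin s 1); auto.
    intros u Hu; apply Rmin_Rgt_l in Hu; destruct Hu as [Hus Hu1].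
    assert (Hd := is_derive_PSeries _ _ (Cs u Hus)).
    (* All coefficients of the derived series equal 1, so it is the geometric series, which cancels
       the derivative of [ln (1 - u)]. *)
    assert (Hg : PSeries (PS_derive (fun n => / INR n)) u = / (1 - u)).
    { apply is_pseries_unique, is_pseries_R.
      apply is_series_ext with (2 := is_series_geom u Hu1); intros n.
      unfold PS_derive.
      rewrite Rinv_r, Rmult_1_l by (apply not_0_INR; lia); reflexivity. }
    rewrite Hg in Hd; apply Rabs_def2 in Hu1.
    unfold f; auto_derive.
    - repeat split; [now exists (/ (1 - u))|lra].
    - change (fun v => PSeries (fun n => / INR n) v)
        with (PSeries (fun n => / INR n)).
      rewrite (is_derive_unique _ _ _ Hd); field; lra. }
  apply Rmin_Rgt_l in Ht; destruct Ht as [Hts Ht1].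
  assert (Hv : PSeries (fun n => / INR n) t = - ln (1 - t)).
  { unfold f in Hf; rewrite PSeries_0, Rminus_0_r, ln_1 in Hf.
    simpl INR in Hf; rewrite Rinv_0 in Hf; lra. }
  rewrite <- Hv; apply PSeries_correct, CV_radius_inside, Cs, Hts.
Qed.

(** * Hyperharmonic and Daehee polynomials *)

Lemma is_gf_hyperharmonic_mult (y : R) :
  is_gf (PS_mult (fun n => (-1) ^ n * gbinom (- y) n) (fun n => / INR n))
    (fun t => - (ln (1 - t) / Rpower (1 - t) y)).
Proof.
  refine (is_gf_ext _ _ _ _ (fun _ => eq_refl) _
    (is_gf_mult _ _ _ _ (is_gf_opp_arg _ _ (is_gf_binomial (- y))) is_gf_log)).
  apply filter_forall; intros t; cbv beta.
  rewrite Rpower_Ropp; unfold Rminus, Rdiv; ring.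
Qed.

Lemma is_gf_hyperharmonic (y : R) :
  is_gf (fun n => hyperharmonic n y)
    (fun t => - (ln (1 - t) / Rpower (1 - t) y)).
Proof.
  apply is_gf_ext with (3 := is_gf_hyperharmonic_mult y).
  - intros n; symmetry; apply gf_coef_eq, is_gf_hyperharmonic_mult.
  - now apply filter_forall.
Qed.

(** This vanishing constant term is what permits the division by [t] in the Daehee generating
    functions. *)
Lemma hyperharmonic_0 (y : R) : hyperharmonic 0 y = 0.
Proof.
  unfold hyperharmonic; rewrite (gf_coef_eq _ _ (is_gf_hyperharmonic_mult y)).
  unfold PS_mult; simpl; rewrite Rinv_0; ring.
Qed.

Lemma hyperharmonic_S (k : nat) (y : R) :
  hyperharmonic (S k) y =
  sum_f_R0 (fun j => (-1) ^ j / (INR k + 1 - INR j) * gbinom (- y) j) k.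
Proof.
  unfold hyperharmonic; rewrite (gf_coef_eq _ _ (is_gf_hyperharmonic_mult y)).
  (* The last term of the Cauchy product, [j = k + 1], carries the factor [/ INR 0 = 0], so the sum
     stops at [k]. *)
  unfold PS_mult; rewrite tech5, Nat.sub_diag; simpl (INR 0).
  rewrite Rinv_0, Rmult_0_r, Rplus_0_r.
  apply sum_eq; intros j Hj.
  rewrite minus_INR, S_INR by lia; unfold Rdiv; ring.
Qed.

(** Upper negation: changing the sign of each factor [- y - i] gives [y + i], and these are the
    factors of the right-hand side in reverse order. *)
Lemma falling_opp (y : R) (m : nat) :
  (-1) ^ m * falling (- y) m = falling (y + INR m - 1) m.
Proof.
  (* [falling] exposes its smallest factor; the reversal requires splitting off the largest one
     instead. *)
  assert (Hl : forall n z, falling z (S n) = z * falling (z - 1) n).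
  { induction n as [|n IH]; intros z; [simpl; ring|].
    change (falling z (S n) * (z - INR (S n)) =
            z * (falling (z - 1) n * (z - 1 - INR n))).
    rewrite IH, S_INR; ring. }
  induction m as [|m IH]; [simpl; ring|].
  rewrite (Hl m (y + INR (S m) - 1)), S_INR.
  replace (y + (INR m + 1) - 1 - 1) with (y + INR m - 1) by ring.
  rewrite <- IH; simpl; ring.
Qed.

Lemma gbinom_opp (y : R) (m : nat) :
  (-1) ^ m * gbinom (- y) m = gbinom (y + INR m - 1) m.
Proof. unfold gbinom, Rdiv; now rewrite <- Rmult_assoc, falling_opp. Qed.

(** Dividing the generating function of [hyperharmonic _ (- x)] by [t] and then replacing [t] by
    [- t] gives that of [Daehee1]; the substitution produces the sign [(-1) ^ k]. *)
Lemma Daehee1_hyperharmonic (k : nat) (x : R) :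
  Daehee1 k x = (-1) ^ k * INR (fact k) * hyperharmonic (S k) (- x).
Proof.
  unfold Daehee1.
  rewrite (egf_coef_eq (fun n => (-1) ^ n * hyperharmonic (S n) (- x))).
  - ring.
  - refine (is_gf_ext _ _ _ _ (fun _ => eq_refl) _ (is_gf_opp_arg _ _
      (is_gf_div_arg _ _ (hyperharmonic_0 (- x)) (is_gf_hyperharmonic (- x))))).
    apply locally'_0_iff; exists 1; split; [lra|]; intros t Ht _.
    replace (1 - - t) with (1 + t) by ring.
    rewrite Rpower_Ropp; field; split; auto.
    unfold Rpower; apply Rgt_not_eq, exp_pos.
Qed.

(** Here the argument is already [1 - t], so division by [t] suffices and no sign appears. *)
Lemma Daehee2_hyperharmonic (k : nat) (x : R) :
  Daehee2 k x = INR (fact k) * hyperharmonic (S k) (x - 1).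
Proof.
  unfold Daehee2.
  rewrite (egf_coef_eq (fun n => hyperharmonic (S n) (x - 1))); auto.
  refine (is_gf_ext _ _ _ _ (fun _ => eq_refl) _
    (is_gf_div_arg _ _ (hyperharmonic_0 (x - 1)) (is_gf_hyperharmonic (x - 1)))).
  apply locally'_0_iff; exists 1; split; [lra|]; intros t Ht _.
  replace (1 - x) with (- (x - 1)) by ring.
  rewrite Rpower_Ropp; field; split; auto.
  unfold Rpower; apply Rgt_not_eq, exp_pos.
Qed.

Theorem theorem2 (k : nat) (x : R) :
  (Daehee1 k x = (-1) ^ k * INR (fact k) * hyperharmonic (k + 1) (- x) /\
   Daehee2 k x = INR (fact k) * hyperharmonic (k + 1) (x - 1)) /\
  (hyperharmonic (k + 1) (- x) =
     sum_f_R0 (fun j => (-1) ^ j / (INR k + 1 - INR j) * gbinom x j) k /\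
   hyperharmonic (k + 1) (x - 1) =
     sum_f_R0 (fun j => 1 / (INR k + 1 - INR j) * gbinom (x + INR j - 2) j) k).
Proof.
  rewrite Nat.add_1_r; repeat split.
  - apply Daehee1_hyperharmonic.
  - apply Daehee2_hyperharmonic.
  - now rewrite hyperharmonic_S, Ropp_involutive.
  - rewrite hyperharmonic_S; apply sum_eq; intros j _.
    (* This is the shape of upper negation, [gbinom_opp], at [y = x - 1]; it absorbs the sign
       [(-1) ^ j]. *)
    replace (x + INR j - 2) with (x - 1 + INR j - 1) by ring.
    rewrite <- gbinom_opp; unfold Rdiv; ring.
Qed.
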